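(* Let $F$ be a germ of automorphisms of $\mathbb{C}^d$ at the origin with local basins of attraction $B_0,\ldots,B_{k-1}$, as described in the context. Then no orbit of $F$ inside the basins $B_0,\ldots,B_{k-1}$ converges to $0$ tangent to a proper complex linear subspace of $\mathbb{C}^d$.
   Context: Notation: $\mathbb{N}=\{0,1,\ldots\}$; upper indices denote components; $e_j$ is the $j$-th unit vector. Setting: $d\ge2$, $k\ge1$, $l>2kd+1$ are integers; $\lambda_1,\ldots,\lambda_d$ have unit modulus and are one-resonant of index $(1,\ldots,1)$, i.e. for $m\in\mathbb{N}^d$ and $j\le d$, $\lambda_1^{m_1}\cdots\lambda_d^{m_d}=\lambda_j$ if and only if $m=(q,\ldots,q)+e_j$ for some $q\in\mathbb{N}$; and $$F(z)=\Lambda z\Bigl(1-\frac{(z^1\cdots z^d)^k}{kd}\Bigr)+O(\|z\|^l),\qquad \Lambda=\mathrm{diag}(\lambda_1,\ldots,\lambda_d).$$ For $\pi(z)=z^1\cdots z^d$, $R>0$, $\theta\in(0,\frac{\pi}{2k})$, $\beta\in(0,\frac1d)$ put $S_h(R,\theta)=\{u\in\mathbb{C}: |u^k-\frac1{2R}|<\frac1{2R},\ |\arg(u)-\frac{2\pi h}{k}|<\theta\}$ (arguments modulo $2\pi$), $W(\beta)=\{z\in\mathbb{C}^d: |z^j|<|\pi(z)|^\beta \text{ for } 1\le j\le d\}$, $B_h(R,\theta,\beta)=\{z\in W(\beta):\pi(z)\in S_h(R,\theta)\}$. Fix $\beta_0\in(0,1/d)$ with $\beta_0(l+d-1)>2k+1$,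 $\theta_0\in(0,\frac\pi{2k})$, and $R_0>0$ large enough that the sets $B_h:=B_h(R_0,\theta_0,\beta_0)$ are uniform local basins of attraction: $F(B_h)\subseteq B_h$ and $F^n\to0$ uniformly on $B_h$, for all $h=0,\ldots,k-1$ (such $R_0$ exists). A sequence $z_n\to0$ of non-zero points converges to $0$ tangent to a linear subspace $V$ if all accumulation points of $z_n/\|z_n\|_2$ lie in $V$. *)

(* Defs.v *)
From HB Require Import structures.
From mathcomp Require Import all_boot all_order all_algebra.
From mathcomp Require Import complex.
From mathcomp Require Import all_classical all_reals all_analysis.
Set Implicit Arguments.
Unset Strict Implicit.
Unset Printing Implicit Defensive.
Import Order.TTheory GRing.Theory Num.Theory.
Import numFieldNormedType.Exports.
Import ComplexField.Normc.
Local Open Scope classical_set_scope.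
Local Open Scope ring_scope.
Local Open Scope complex_scope.

(* R[i] as a normed space over itself, as for any numFieldType: the generic
   instances are not found by unification on the head constant [complex]. *)
HB.instance Definition _ (R : realType) := NormedModule.copy R[i] (R[i])^o.

(* The norm `|z| of z : R[i] is R[i]-valued, and `|z| on 'cV[R[i]]_d is the
   (R[i]-valued) sup norm; [normc] and [enorm] are the R-valued modulus and
   Euclidean norm. *)
Definition enorm (R : realType) (d : nat) (z : 'cV[R[i]]_d) : R :=
  Num.sqrt (\sum_(j < d) normc (z j 0) ^+ 2).

(* One-resonance of index (1, ..., 1). *)
Definition one_resonant1 (R : realType) (d : nat) (lam : 'rV[R[i]]_d) : Prop :=
  forall (m : 'I_d -> nat) (j : 'I_d),
    \prod_(i < d) lam 0 i ^+ m i = lam 0 j <->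
    exists q : nat, forall i : 'I_d, m i = (q + (i == j))%N.

Definition prod_coord (R : realType) (d : nat) (z : 'cV[R[i]]_d) : R[i] :=
  \prod_(j < d) z j 0.

(* [differentiable] is over the scalar field R[i], i.e. complex (Frechet)
   differentiability; on an open set this is holomorphy. *)
Definition holomorphic_on (R : realType) (d : nat) (U : set 'cV[R[i]]_d)
    (F : 'cV[R[i]]_d -> 'cV[R[i]]_d) : Prop :=
  forall z, U z -> differentiable F z.

(* F represents, on the open neighbourhood U of 0, a germ at 0 of automorphisms
   of C^d fixing 0: it has a holomorphic inverse germ. Values of F outside U
   carry no information. *)
Definition automorphism_germ (R : realType) (d : nat) (U : set 'cV[R[i]]_d)
    (F : 'cV[R[i]]_d -> 'cV[R[i]]_d) : Prop :=
  [/\ open U, U 0, holomorphic_on U F, F 0 = 0 &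
      exists (V : set 'cV[R[i]]_d) (G : 'cV[R[i]]_d -> 'cV[R[i]]_d),
        [/\ [/\ open V, V 0 & holomorphic_on V G], G 0 = 0,
            \forall z \near (0 : 'cV[R[i]]_d), G (F z) = z &
            \forall z \near (0 : 'cV[R[i]]_d), F (G z) = z]].

Definition normal_form (R : realType) (d k : nat) (lam : 'rV[R[i]]_d)
    (z : 'cV[R[i]]_d) : 'cV[R[i]]_d :=
  (1 - prod_coord z ^+ k / (k * d)%:R) *: (diag_mx lam *m z).

Definition petal (R : realType) (k h : nat) (r theta : R) : set R[i] :=
  [set u : R[i] | normc (u ^+ k - ((2 * r)^-1)%:C) < (2 * r)^-1 /\
     exists t : R, u = (normc u)%:C * (cos t +i* sin t) /\
       `|t - 2 * pi * h%:R / k%:R| < theta].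

Definition Wset (R : realType) (d : nat) (beta : R) : set 'cV[R[i]]_d :=
  [set z : 'cV[R[i]]_d | forall j : 'I_d, normc (z j 0) < normc (prod_coord z) `^ beta].

Definition basin (R : realType) (d k h : nat) (r theta beta : R) :
    set 'cV[R[i]]_d :=
  [set z : 'cV[R[i]]_d | Wset beta z /\ petal k h r theta (prod_coord z)].

Definition uniform_local_basin (R : realType) (d : nat)
    (F : 'cV[R[i]]_d -> 'cV[R[i]]_d) (B : set 'cV[R[i]]_d) : Prop :=
  (F @` B `<=` B) /\ {uniform B, (fun n => iter n F) @ \oo --> (fun=> (0 : 'cV[R[i]]_d))}.

Definition cvg0_tangent (R : realType) (d : nat) (z : nat -> 'cV[R[i]]_d)
    (V : {vspace 'cV[R[i]]_d}) : Prop :=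
  [/\ forall n, z n != 0, z @ \oo --> (0 : 'cV[R[i]]_d) &
      cluster ((fun n => ((enorm (z n))^-1)%:C *: z n) @ \oo) `<=` [set` V]].

(* Main.v *)
(* Put u = z^1 ... z^d and v = u^k along the orbit. Inside the basins the error term
   is O(|v|^2) relatively to each coordinate, so
     z_{n+1}^j = lambda_j z_n^j (1 - v_n / (kd) + O(|v_n|^2)).
   The petals give Re v >= c |v| with c > 0, so |v_{n+1}| <= |v_n| - c' |v_n|^2
   eventually: |v_n|^2 is summable and the ratios |z_n^i| / |z_n^j| stay bounded.
   Hence the directions z_n / ||z_n|| have an accumulation point p with all
   coordinates non-zero. Their accumulation set is invariant under Lambda, because
   z_{n+1} = Lambda z_n (1 + o(1)) coordinatewise, and the lambda_j are distinct by
   one-resonance, so the Lambda^s p span C^d. *)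
Require Import Defs.
From HB Require Import structures.
From mathcomp Require Import all_boot all_order all_algebra.
From mathcomp Require Import complex.
From mathcomp Require Import all_classical all_reals all_analysis.
From mathcomp Require Import ring lra.
Import Order.TTheory GRing.Theory Num.Theory.
Import numFieldNormedType.Exports.
Local Open Scope classical_set_scope.
Local Open Scope ring_scope.
Local Open Scope complex_scope.

Import ComplexField.Normc.

(** * Real-valued modulus on [R[i]] and the sector cut out by a petal *)

Section Modulus.
Context {R : realType}.
Implicit Types x y : R[i].

Lemma normr_normc x : `|x| = (normc x)%:C.
Proof. by rewrite normc_def; case: x. Qed.

Lemma normc_ge0 x : 0 <= normc x.
Proof. by case: x => a b; apply: sqrtr_ge0. Qed.

Lemma normc_eq0 x : (normc x == 0) = (x == 0).
Proof. by apply/eqP/eqP => [/eq0_normc|->] //; rewrite normc0. Qed.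

Lemma normc_gt0 x : (0 < normc x) = (x != 0).
Proof. by rewrite lt_def normc_ge0 normc_eq0 andbT. Qed.

Lemma normc_triangle x y : normc (x + y) <= normc x + normc y.
Proof. exact: le_normcD. Qed.

Lemma normc_opp x : normc (- x) = normc x.
Proof. exact: normcN. Qed.

Lemma normc_sub_ge x y : normc x - normc y <= normc (x + y).
Proof.
by have := normc_triangle (x + y) (- y); rewrite addrK normc_opp; lra.
Qed.

Lemma normcX x n : normc (x ^+ n) = normc x ^+ n.
Proof.
by elim: n => [|n IH]; rewrite ?expr0 ?normc1// !exprS normcM IH.
Qed.

Lemma normc_prod (I : finType) (P : pred I) (f : I -> R[i]) :
  normc (\prod_(i | P i) f i) = \prod_(i | P i) normc (f i).
Proof. by apply: (big_morph (@normc R)); [exact: normcM|exact: normc1]. Qed.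

Lemma normc_real (a : R) : normc a%:C = `|a|.
Proof. by rewrite /normc/= expr0n/= addr0 sqrtr_sqr. Qed.

Lemma normc_nat n : normc (n%:R : R[i]) = n%:R.
Proof. by rewrite -[n%:R](rmorph_nat (real_complex R)) normc_real normr_nat. Qed.

Lemma sqr_normcE x : normc x ^+ 2 = complex.Re x ^+ 2 + complex.Im x ^+ 2.
Proof. by case: x => a b /=; rewrite sqr_sqrtr// addr_ge0 ?sqr_ge0. Qed.

(** Both sides are compared through their squares, whose difference is a sum of non-negative terms;
    [c <= 1] makes the right-hand side non-negative. *)
Lemma normc_sub1_le (c : R) x : c <= 1 -> c * normc x <= complex.Re x ->
  normc (1 - x) <= 1 - c * normc x + normc x ^+ 2.
Proof.
move=> c1 cx; have x0 := normc_ge0 x; set s := normc x in x0 cx *.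
rewrite -(@ler_pXn2r _ 2)// ?nnegrE ?normc_ge0//; last by nra.
have -> : normc (1 - x) ^+ 2 = 1 - 2 * complex.Re x + s ^+ 2.
  by rewrite !sqr_normcE; case: (x) => a b /=; ring.
rewrite -subr_ge0.
have -> : (1 - c * s + s ^+ 2) ^+ 2 - (1 - 2 * complex.Re x + s ^+ 2) =
  s ^+ 2 + (s * (c - s)) ^+ 2 + 2 * (complex.Re x - c * s) by ring.
by rewrite !addr_ge0 ?sqr_ge0// mulr_ge0// subr_ge0.
Qed.

Lemma normc_le_ReIm x : normc x <= `|complex.Re x| + `|complex.Im x|.
Proof.
rewrite -(@ler_pXn2r _ 2)// ?nnegrE ?normc_ge0 ?addr_ge0//.
rewrite sqr_normcE -(real_normK (num_real (complex.Re x))) -(real_normK (num_real (complex.Im x))).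
by have := normr_ge0 (complex.Re x); have := normr_ge0 (complex.Im x); nra.
Qed.

Lemma normr_Re_le x : `|complex.Re x| <= normc x.
Proof.
rewrite -(@ler_pXn2r _ 2)// ?nnegrE ?normc_ge0//.
by rewrite sqr_normcE real_normK ?num_real// lerDl sqr_ge0.
Qed.

Lemma normr_Im_le x : `|complex.Im x| <= normc x.
Proof.
rewrite -(@ler_pXn2r _ 2)// ?nnegrE ?normc_ge0//.
by rewrite sqr_normcE real_normK ?num_real// lerDr sqr_ge0.
Qed.

Lemma cis_exp (t : R) n :
  (cos t +i* sin t) ^+ n = cos (n%:R * t) +i* sin (n%:R * t).
Proof.
elim: n => [|n IH]; first by rewrite !mul0r cos0 sin0.
rewrite exprS IH -natr1 mulrDl mul1r [n%:R * t + t]addrC cosD sinD.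
by simpc; congr (_ +i* _); ring.
Qed.

(** The open disc has [0] on its boundary, so it excludes [u = 0]. Raising to the power [k] turns
    the offset [2 * pi * h / k] into a full number of turns, so [u ^+ k] has an argument of size
    less than [k * theta < pi / 2], whatever [h] is. *)
Lemma petal_sector {k h : nat} {r theta : R} {u : R[i]} : (0 < k)%N ->
  0 < theta < pi / (2 * k%:R) -> petal k h r theta u ->
  u != 0 /\ cos (k%:R * theta) * normc (u ^+ k) <= complex.Re (u ^+ k).
Proof.
move=> k0 /andP[th0 th1] [ur [t [ut tth]]].
have kR : 0 < k%:R :> R by rewrite ltr0n.
split.
  apply: contraTneq ur => ->; rewrite expr0n eqn0Ngt k0 sub0r normc_opp.
  rewrite normc_real -leNgt; exact: ler_norm.
rewrite {2}ut exprMn cis_exp -rmorphXn -normcX/=.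
set s := k%:R * (t - 2 * pi * h%:R / k%:R).
have -> : k%:R * t = s + pi *+ 2 *+ h.
  by rewrite /s -(mulr_natr _ h) -(mulr_natr pi 2); field; rewrite gt_eqF.
rewrite (periodicn (@cosD2pi _)) mul0r subr0 mulrC ler_wpM2l ?normc_ge0//.
have kth : k%:R * theta < pi / 2.
  by rewrite -ltr_pdivlMl//; move: th1; rewrite invfM mulrA mulrC mulrA.
have kth0 : 0 < k%:R * theta by rewrite mulr_gt0.
have sk : `|s| < k%:R * theta by rewrite normrM gtr0_norm// ltr_pM2l.
have p0 := pi_gt0 R; rewrite -(cos_norm s).
by rewrite ltW// ltr_cos ?in_itv/= ?normr_ge0; lra.
Qed.

End Modulus.

(** * Cyclic vectors of a diagonal matrix *)

(** Applying all factors [D - lam 0 i] with [i != j] to [p] kills every coordinate except the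
    [j]-th, which stays non-zero because the eigenvalues are distinct. Thus [V] contains each unit
    vector. *)
Lemma diag_orbit_span (K : fieldType) (d : nat) (lam : 'rV[K]_d)
    (p : 'cV[K]_d) (V : {vspace 'cV[K]_d}) :
  injective (lam 0) -> (forall j, p j 0 != 0) ->
  (forall s, iter s (mulmx (diag_mx lam)) p \in V) -> V = fullv.
Proof.
set D := mulmx (diag_mx lam) => lam_inj p0 Vp.
pose q S := foldr (fun i w => D w - lam 0 i *: w) p S.
have DE w j : D w j 0 = lam 0 j * w j 0 by rewrite /D mul_diag_mx mxE.
have qE S j : q S j 0 = (\prod_(i <- S) (lam 0 j - lam 0 i)) * p j 0.
  elim: S => [|i S IH]; first by rewrite big_nil mul1r.
  by rewrite big_cons /= mxE DE 2!mxE IH -mulrA mulrBl.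
have iterB s w i :
    iter s D (D w - lam 0 i *: w) = iter s.+1 D w - lam 0 i *: iter s D w.
  elim: s => // s IH; rewrite iterS IH [in RHS]iterS.
  by rewrite {1}/D mulmxBr -scalemxAr.
(* All iterates are treated at once: each new factor of [q] moves from [s] to [s.+1]. *)
have Vq S s : iter s D (q S) \in V.
  elim: S s => // i S IH s /=.
  by rewrite iterB; apply: rpredB; [exact: IH|apply: rpredZ; exact: IH].
have Ve j : delta_mx j 0 \in V.
  pose S := [seq i <- enum 'I_d | i != j].
  pose c := (\prod_(i <- S) (lam 0 j - lam 0 i)) * p j 0.
  have c0 : c != 0.
    rewrite mulf_neq0// prodf_seq_neq0; apply/allP => i.
    rewrite mem_filter => /andP[ij _] /=.
    by rewrite subr_eq0; apply: contraNneq ij => /lam_inj ->.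
  have -> : delta_mx j 0 = c^-1 *: q S.
    apply/colP => i; rewrite !mxE qE eqxx andbT.
    have [->|ij] := eqVneq i j; first by rewrite mulVf.
    rewrite (big_rem i)/= ?subrr ?mul0r ?mulr0//.
    by rewrite mem_filter ij mem_enum.
  by apply: rpredZ; apply: (Vq S 0).
apply/eqP; rewrite eqEsubv subvf; apply/subvP => v _.
rewrite [v]matrix_sum_delta; apply: rpred_sum => i _; apply: rpred_sum => k _.
by rewrite ord1; apply: rpredZ.
Qed.

(** * Accumulation points of sequences of vectors *)

Section LimitPoints.
Context {R : realType} {d : nat}.
Implicit Types (x : nat -> 'cV[R[i]]_d) (p : 'cV[R[i]]_d).

(** Accumulation at [p] with real radii and coordinatewise moduli, which keeps later estimates in
    [R] although the balls of the topology have radii in [R[i]]. *)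
Definition limit_pt x p := forall e : R, 0 < e -> forall N : nat,
  exists2 n, (N <= n)%N & forall j, normc (x n j 0 - p j 0) < e.

Lemma limit_pt_cluster x p : limit_pt x p -> cluster (x @ \oo) p.
Proof.
move=> xp A B [N _ NA] /nbhs_ballP[e /= e0 eB].
(* A positive element of [R[i]] has zero imaginary part, so the radius is real. *)
have [eR e'0] : e = (complex.Re e)%:C /\ 0 < complex.Re e.
  by case: e e0 {eB} => a b; rewrite ltcE/= => /andP[/eqP-> a0].
have [n Nn xn] := xp _ e'0 N; exists (x n); split; first exact: NA.
apply: eB; split => // i j; rewrite ord1 -ball_normE /= distrC.
by rewrite normr_normc eR ltcR.
Qed.

(** Bolzano-Weierstrass: real and imaginary parts are stored in one vector of the compact cube of
    side [[-1, 1]] in dimension [d + d]. *)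
Lemma bounded_limit_pt x : (forall n j, normc (x n j 0) <= 1) ->
  exists p, limit_pt x p.
Proof.
move=> x1; pose w n : 'rV[R]_(d + d) := row_mx
  (\row_j complex.Re (x n j 0)) (\row_j complex.Im (x n j 0)).
have wK n i : `[-1, 1]%classic (w n ord0 i).
  rewrite /= in_itv/= -ler_norml /w.
  case: (split_ordP i) => j ->; rewrite ?row_mxEl ?row_mxEr mxE.
    exact: le_trans (normr_Re_le _) (x1 _ _).
  exact: le_trans (normr_Im_le _) (x1 _ _).
have cK := rV_compact (fun _ : 'I_(d + d) => @segment_compact R (-1) 1).
have [|y [_ yw]] := cK (w @ \oo) _; first by exists 0 => // n _ i; exact: wK.
exists (\col_j (y ord0 (lshift d j) +i* y ord0 (rshift d j))).
move=> e e0 N.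
have [||_ [[n Nn <-] [_ ywn]]] := yw (w @` [set n | (N <= n)%N]) (ball y (e / 2)).
- by exists N => // n Nn; exists n.
- by apply: nbhsx_ballx; rewrite divr_gt0.
exists n => // j; rewrite mxE; apply: le_lt_trans (normc_le_ReIm _) _.
have := ywn ord0 (lshift d j); have := ywn ord0 (rshift d j).
rewrite -!ball_normE /= row_mxEl row_mxEr !mxE.
rewrite [`|y _ (lshift _ _) - _|]distrC [`|y _ (rshift _ _) - _|]distrC.
by case: (x n j 0) => a b /=; lra.
Qed.

End LimitPoints.

(** * Comparability of the coordinates under parabolic decay *)

(* [a] decreases at rate [a ^+ 2], while the ratio [zeta n i / zeta n j] changes
   by a factor [1 + O(a n ^+ 2)]; hence [zeta n i / zeta n j * expR (A * a n)] is
   nonincreasing once [A] is large. *)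
Lemma comparable_of_parabolic {R : realType} {d k : nat}
    (a rho : nat -> R) (f zeta : nat -> 'I_d -> R) (C c : R) :
  (0 < d)%N -> (0 < k)%N -> 0 <= C -> 0 < c ->
  (forall n, 0 <= a n) -> (forall n j, 0 < zeta n j) ->
  (forall e, 0 < e -> exists N, forall n, (N <= n)%N -> a n <= e) ->
  exists N0, forall N, (N0 <= N)%N ->
  (forall n, (N <= n)%N -> forall j, zeta n.+1 j = zeta n j * f n j) ->
  (forall n, (N <= n)%N -> forall j, `|f n j - rho n| <= C * a n ^+ 2) ->
  (forall n, (N <= n)%N -> a n.+1 = a n * \prod_j f n j ^+ k) ->
  (forall n, (N <= n)%N -> 1 - a n <= rho n <= 1 - c * a n + a n ^+ 2) ->
  exists2 K, 0 < K & forall n i j, (N <= n)%N -> zeta n i <= K * zeta n j.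
Proof.
move=> d0 k0 C0 c0 a0 zeta0 a_cvg0.
(* Below the threshold [s], the bound [(1 + C) * s <= c / 2] absorbs the quadratic terms into half
   of the linear decay, while [C * s <= 1] and [s <= 1 / 4] keep every factor above [1 / 2]. *)
have [s /andP[s0 s14] sC] :
    exists2 s : R, 0 < s <= 1 / 4 & (1 + C) * s <= c / 2 /\ C * s <= 1.
  have C1 : 0 < 1 + C by lra.
  exists (Num.min (1 / 4) (Num.min (c / 2 / (1 + C)) (1 / (1 + C)))).
    by rewrite ge_min lexx /= andbT !lt_min !divr_gt0//; lra.
  set t := Num.min (1 / 4) _.
  have t1 : t <= c / 2 / (1 + C) by rewrite !ge_min lexx !orbT.
  have t2 : t <= 1 / (1 + C) by rewrite !ge_min lexx !orbT.
  have t0 : 0 <= t by rewrite !le_min !divr_ge0//; lra.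
  rewrite ler_pdivlMr// in t1; rewrite ler_pdivlMr// in t2.
  by split; lra.
have [N0 aN0] := a_cvg0 _ s0; exists N0 => N N0N zetaS f_rho aS rho_bnd.
have aN n : (N <= n)%N -> a n <= s by move=> Nn; apply/aN0/(leq_trans N0N).
have f_bnd n j : (N <= n)%N -> 1 / 2 <= f n j <= 1 - c / 2 * a n.
  move=> Nn; have := f_rho _ Nn j; have := rho_bnd _ Nn; have := aN _ Nn.
  have := a0 n; rewrite ler_distl; set b := a n.
  move=> b0 bs /andP[r1 r2] /andP[f1 f2].
  have Cb : C * b ^+ 2 <= 1 / 4.
    have -> : C * b ^+ 2 = (C * b) * b by ring.
    have Cb1 : C * b <= 1 by apply: le_trans sC.2; rewrite ler_wpM2l.
    have := ler_wpM2r b0 Cb1; lra.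
  have : (1 + C) * b * b <= c / 2 * b.
    by rewrite ler_wpM2r//; apply: le_trans sC.1; rewrite ler_wpM2l//; lra.
  have := sqr_ge0 b; lra.
(* All factors lie in [[0, 1]], so a single one, to the first power, already bounds the product. *)
have prod_le n : (N <= n)%N -> \prod_j f n j ^+ k <= 1 - c / 2 * a n.
  move=> Nn; rewrite (bigD1 (Ordinal d0))//=.
  have f01 j : 0 <= f n j <= 1.
    have /andP[f1 f2] := f_bnd _ j Nn; have := mulr_ge0 (ltW c0) (a0 n); lra.
  have /andP[_] := f_bnd _ (Ordinal d0) Nn; apply: le_trans.
  have /andP[g0 g1] := f01 (Ordinal d0).
  rewrite -[leRHS]mulr1; apply: ler_pM => //; first exact: exprn_ge0.
  - by apply: prodr_ge0 => j _; apply: exprn_ge0; have /andP[] := f01 j.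
  - by rewrite -[leRHS]expr1; apply: ler_wiXn2l.
  - apply: prodr_ile1 => j _; have /andP[h0 h1] := f01 j.
    by rewrite exprn_ge0//= exprn_ile1.
have a_decr n : (N <= n)%N -> a n.+1 <= a n - c / 2 * a n ^+ 2.
  move=> Nn; rewrite aS//; have := ler_wpM2l (a0 n) (prod_le _ Nn); lra.
(* With this [A], the decrease of [A * a n] is at least [A * (c / 2) * a n ^+ 2 = 4 * C * a n ^+ 2],
   which pays for the growth of the ratio in [f_ij]. *)
pose A := 8 * C / c.
have A0 : 0 <= A by rewrite divr_ge0//; lra.
(* The sum over all pairs is a crude majorant of each initial ratio. *)
pose K := \sum_i \sum_j zeta N i * expR (A * a N) / zeta N j.
have Kij0 i j : 0 <= zeta N i * expR (A * a N) / zeta N j.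
  by rewrite divr_ge0// ?mulr_ge0 ?expR_ge0// ltW.
have K0 i j : zeta N i * expR (A * a N) / zeta N j <= K.
  rewrite /K (bigD1 i)//= (bigD1 j)//= -addrA lerDl addr_ge0//.
    exact: sumr_ge0.
  by apply: sumr_ge0 => i' _; apply: sumr_ge0.
exists K.
  by apply: lt_le_trans (K0 (Ordinal d0) (Ordinal d0)); rewrite divr_gt0 ?mulr_gt0 ?expR_gt0.
have main n i j : (N <= n)%N -> zeta n i * expR (A * a n) <= K * zeta n j.
  move=> /subnK <-; elim: (n - N)%N => [|{}n IH].
    by rewrite -ler_pdivrMr.
  rewrite addSn; move: IH; set m := (n + N)%N => IH.
  have Nm : (N <= m)%N by rewrite leq_addl.
  rewrite !zetaS//.
  have /andP[fi _] := f_bnd _ i Nm; have /andP[fj _] := f_bnd _ j Nm.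
  have fij : f m i * expR (A * a m.+1) <= f m j * expR (A * a m).
    (* The two factors differ by at most [2 * (C * a m ^+ 2)], and [f m j >= 1 / 2] turns this into
       a relative error with constant [4]. *)
    have f_ij : f m i <= f m j * (1 + 4 * (C * a m ^+ 2)).
      have := f_rho _ Nm i; have := f_rho _ Nm j; rewrite !ler_distl.
      have : 0 <= C * a m ^+ 2 by rewrite mulr_ge0// sqr_ge0.
      by set e := C * _; move=> e0 /andP[? ?] /andP[? ?]; nra.
    have e4 : 4 * (C * a m ^+ 2) + A * a m.+1 <= A * a m.
      have := ler_wpM2l A0 (a_decr _ Nm); rewrite mulrBr.
      have -> : A * (c / 2 * a m ^+ 2) = 4 * (C * a m ^+ 2).
        by rewrite /A; field; rewrite gt_eqF.
      by lra.
    apply: (@le_trans _ _ (f m j * (expR (4 * (C * a m ^+ 2)) * expR (A * a m.+1)))).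
      rewrite mulrA ler_wpM2r ?expR_ge0//; apply: le_trans f_ij _.
      by rewrite ler_wpM2l ?expR_ge1Dx//; lra.
    by rewrite -expRD ler_wpM2l ?ler_expR//; lra.
  have fj0 : 0 <= f m j by lra.
  have := ler_wpM2l (ltW (zeta0 m i)) fij; have := ler_wpM2r fj0 IH.
  by lra.
move=> n i j Nn; apply: le_trans (main _ _ _ Nn).
apply: ler_peMr; first exact: ltW.
by apply: le_trans (expR_ge1Dx _); rewrite lerDl mulr_ge0.
Qed.

(** * Directions and their accumulation points *)

Section Direction.
Context {R : realType} {d : nat}.
Implicit Types z w : 'cV[R[i]]_d.

Definition direction z : 'cV[R[i]]_d := ((enorm z)^-1)%:C *: z.

Lemma enorm_ge0 z : 0 <= enorm z.
Proof. exact: sqrtr_ge0. Qed.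

Lemma sqr_enorm z : enorm z ^+ 2 = \sum_j normc (z j 0) ^+ 2.
Proof. by rewrite sqr_sqrtr// sumr_ge0// => j _; exact: sqr_ge0. Qed.

Lemma le_enorm_scale z w (t : R) : 0 <= t ->
  (forall j, normc (z j 0) <= t * normc (w j 0)) -> enorm z <= t * enorm w.
Proof.
move=> t0 zw.
rewrite -(@ler_pXn2r _ 2)// ?nnegrE ?mulr_ge0 ?enorm_ge0//.
rewrite exprMn !sqr_enorm mulr_sumr; apply: ler_sum => j _.
by rewrite -exprMn ler_pXn2r ?nnegrE ?mulr_ge0 ?normc_ge0.
Qed.

Lemma normc_le_enorm z j : normc (z j 0) <= enorm z.
Proof.
rewrite -(@ler_pXn2r _ 2)// ?nnegrE ?enorm_ge0 ?normc_ge0// sqr_enorm.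
by rewrite (bigD1 j)//= lerDl sumr_ge0// => i _; exact: sqr_ge0.
Qed.

Lemma enorm_le_const z (t : R) : 0 <= t ->
  (forall j, normc (z j 0) <= t) -> enorm z <= d%:R * t.
Proof.
move=> t0 zt; rewrite -(@ler_pXn2r _ 2)// ?nnegrE ?enorm_ge0 ?mulr_ge0//.
rewrite sqr_enorm exprMn; apply: (@le_trans _ _ (\sum_(j < d) t ^+ 2)).
  by apply: ler_sum => j _; rewrite ler_pXn2r ?nnegrE ?normc_ge0.
rewrite sumr_const card_ord -[leLHS]mulr_natl ler_wpM2r ?sqr_ge0//.
by rewrite -natrX ler_nat -mulnn; case: d => // n; exact: leq_pmulr.
Qed.

Lemma normc_direction z j :
  normc (direction z j 0) = (enorm z)^-1 * normc (z j 0).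
Proof. by rewrite mxE normcM normc_real ger0_norm// invr_ge0 enorm_ge0. Qed.

Lemma normc_direction_le1 z j : normc (direction z j 0) <= 1.
Proof.
rewrite normc_direction mulrC; have := enorm_ge0 z.
rewrite le_eqVlt => /predU1P[<-|z0]; first by rewrite invr0 mulr0.
by rewrite ler_pdivrMr// mul1r normc_le_enorm.
Qed.

(** The [lam 0 j] have modulus one, so the ratio of consecutive norms tends to [1]. Hence the
    direction at [n.+1] is asymptotic to [diag_mx lam] applied to the direction at [n]. *)
Lemma limit_pt_direction_step (lam : 'rV[R[i]]_d) (z : nat -> 'cV[R[i]]_d)
    (eta : nat -> 'I_d -> R[i]) (p : 'cV[R[i]]_d) :
  (forall j, normc (lam 0 j) = 1) -> (forall n, 0 < enorm (z n)) ->
  (exists N0, forall n j, (N0 <= n)%N ->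
     z n.+1 j 0 = lam 0 j * z n j 0 * (1 + eta n j)) ->
  (forall e, 0 < e -> exists N, forall n j, (N <= n)%N -> normc (eta n j) <= e) ->
  limit_pt (direction \o z) p -> limit_pt (direction \o z) (diag_mx lam *m p).
Proof.
move=> lam1 z0 [N0 zS] eta0 zp e e0 N.
(* The bound [1 / 2] gives [a / b <= 2] for consecutive norms [a], [b]; the bound [e / 8] then makes
   the error [2 * s * 2] at most [e / 2]. *)
pose s := Num.min (1 / 2) (e / 8).
have s0 : 0 < s by rewrite lt_min !divr_gt0.
have s1 : s <= 1 / 2 by rewrite ge_min lexx.
have s2 : s <= e / 8 by rewrite ge_min lexx orbT.
have [N1 etaN] := eta0 _ s0.
have [n Nn xn] := zp _ (divr_gt0 e0 (ltr0n _ 2)) (maxn N (maxn N0 N1)).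
move: Nn; rewrite !geq_max => /and3P[Nn N0n N1n].
exists n.+1; first exact: leqW.
have zSn j : normc (z n.+1 j 0) = normc (1 + eta n j) * normc (z n j 0).
  by rewrite zS// !normcM lam1 mul1r mulrC.
have etas j := etaN _ j N1n.
have up : enorm (z n.+1) <= (1 + s) * enorm (z n).
  apply: le_enorm_scale => [|j]; first by lra.
  rewrite zSn ler_wpM2r ?normc_ge0//; have := normc_triangle 1 (eta n j).
  by rewrite normc1; have := etas j; lra.
have lo : enorm (z n) <= (1 - s)^-1 * enorm (z n.+1).
  apply: le_enorm_scale => [|j]; first by rewrite invr_ge0; lra.
  rewrite -[leRHS]mulrC ler_pdivlMr; last by lra.
  rewrite zSn mulrC ler_wpM2r ?normc_ge0//; have := normc_sub_ge 1 (eta n j).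
  by rewrite normc1; have := etas j; lra.
rewrite -[leRHS]mulrC ler_pdivlMr in lo; last by lra.
move=> j; have -> : (diag_mx lam *m p) j 0 = lam 0 j * p j 0.
  by rewrite mul_diag_mx mxE.
rewrite /=; set a := enorm (z n) in up lo *.
have a0 : 0 < a := z0 n.
set b := enorm (z n.+1) in up lo *; have b0 : 0 < b := z0 n.+1.
(* The first bracket rewrites [(1 + eta n j) * (a / b) - 1], so that both small quantities
   [1 - b / a] and [eta n j] appear. *)
have -> : direction (z n.+1) j 0 - lam 0 j * p j 0 =
   lam 0 j * direction (z n) j 0 * (((1 - b / a)%:C + eta n j) * (a / b)%:C)
   + lam 0 j * (direction (z n) j 0 - p j 0).
  rewrite !mxE zS//= -/a -/b !rmorphM/= !rmorphB !rmorphM/= !fmorphV/= rmorph1.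
  have aC : a%:C != 0 by rewrite -normc_eq0 normc_real normr_eq0 gt_eqF.
  have bC : b%:C != 0 by rewrite -normc_eq0 normc_real normr_eq0 gt_eqF.
  by field; rewrite aC bC.
apply: le_lt_trans (normc_triangle _ _) _; rewrite !normcM lam1 !mul1r.
have ab0 : 0 < a / b by rewrite divr_gt0.
have ab2 : a / b <= 2 by rewrite ler_pdivrMr//; nra.
have ba : `|1 - b / a| <= s.
  rewrite distrC ler_distl; apply/andP; split.
    by rewrite ler_pdivlMr//; lra.
  by rewrite ler_pdivrMr//; lra.
have h1 : normc ((1 - b / a)%:C + eta n j) <= 2 * s.
  apply: le_trans (normc_triangle _ _) _; rewrite normc_real.
  by have := etas j; lra.
have h2 : normc (direction (z n) j 0) *
   (normc ((1 - b / a)%:C + eta n j) * normc (a / b)%:C) <= e / 2.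
  rewrite normc_real gtr0_norm//.
  apply: (@le_trans _ _ (1 * (2 * s * 2))); last by lra.
  apply: ler_pM; [exact: normc_ge0| |exact: normc_direction_le1|].
    by rewrite mulr_ge0 ?normc_ge0// ltW.
  by apply: ler_pM => //; [exact: normc_ge0|exact: ltW].
by rewrite [e]splitr; apply: ler_ltD h2 (xn j).
Qed.

End Direction.

(** * Coordinatewise estimates for convergence, the normal form and resonance *)

Lemma cvg0_coord {R : realType} {d : nat} {z : nat -> 'cV[R[i]]_d} :
  z @ \oo --> (0 : 'cV[R[i]]_d) -> forall e : R, 0 < e ->
  exists N, forall n, (N <= n)%N -> forall j, normc (z n j 0) < e.
Proof.
move=> z_cvg e e0.
have eC0 : 0 < e%:C by rewrite ltcR.
have /z_cvg[N _ zN] : nbhs (0 : 'cV[R[i]]_d) (ball (0 : 'cV[R[i]]_d) e%:C).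
  exact: nbhsx_ballx.
exists N => n Nn j; have [_ /(_ j 0)] := zN n Nn.
by rewrite -ball_normE /= mxE sub0r normrN normr_normc ltcR.
Qed.

(** The constant and the radius hidden in the big O are made real. The free bound [t] on the
    coordinates allows the later choice of a power of the modulus of [prod_coord z]. *)
Lemma eqaddO_coord {R : realType} {d l : nat} {F G : 'cV[R[i]]_d -> 'cV[R[i]]_d} :
  F = G +O_ (0 : 'cV[R[i]]_d) (fun z => `|z| ^+ l : (R[i])^o) ->
  exists C e : R, [/\ 0 <= C, 0 < e & forall (z : 'cV[R[i]]_d) (t : R), 0 <= t ->
    (forall j, normc (z j 0) < e) -> (forall j, normc (z j 0) <= t) ->
    forall j, normc (F z j 0 - G z j 0) <= C * t ^+ l].
Proof.
move=> /eqaddOP /bigO_exP[C /= C0 /nbhs_ballP[e /= e0 FG]].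
have realE (x : R[i]) : 0 < x -> x = (complex.Re x)%:C /\ 0 < complex.Re x.
  by case: x => a b; rewrite ltcE/= => /andP[/eqP-> a0].
have [CE CR0] := realE _ C0; have [eE eR0] := realE _ e0.
exists (complex.Re C), (complex.Re e); split => // [|z t t0 ze zt j].
  exact: ltW.
have /FG : ball (0 : 'cV[R[i]]_d) e z.
  split=> // i j'; rewrite ord1 -ball_normE /= mxE sub0r normrN normr_normc.
  by rewrite eE ltcR.
have zt' : `|z| <= t%:C.
  rewrite -[`|z|]/(mx_norm z).
  have [->|/mx_norm_neq0[[i j'] /= ->]] := eqVneq (mx_norm z) 0.
    by rewrite lecR.
  by rewrite ord1 normr_normc lecR.
have FGj : `|F z j 0 - G z j 0| <= `|(F - G) z|.
  have -> : F z j 0 - G z j 0 = (F - G) z j 0 by rewrite !mxE.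
  rewrite -[leRHS]/(mx_norm ((F - G) z)) mx_normE.
  exact: (@le_bigmax _ _ _ _ (fun i => (`|(F - G) z i.1 i.2|%:nng)) (j, 0)).
move=> /(le_trans FGj); rewrite -lecR normr_normc => /le_trans; apply.
rewrite rmorphM/= -CE ler_wpM2l ?(ltW C0)// rmorphXn/= normrX normr_id.
by apply: lerXn2r; rewrite ?nnegrE ?lecR.
Qed.

Lemma prod_coord_le {R : realType} {d : nat} {z : 'cV[R[i]]_d} {t : R} (j : 'I_d) :
  (forall i, normc (z i 0) <= t) ->
  normc (prod_coord z) <= normc (z j 0) * t ^+ d.-1.
Proof.
move=> zt; rewrite normc_prod (bigD1 j)//= ler_wpM2l ?normc_ge0//.
have -> : t ^+ d.-1 = \prod_(i < d | i != j) t.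
  by rewrite prodr_const cardC1 card_ord.
by apply: ler_prod => i _; rewrite normc_ge0 zt.
Qed.

(** If [lam 0 i = lam 0 j] with [i != j], the exponent [m = e_i] is resonant for [j]; then
    [m j = q + 1], although [m j = 0]. *)
Lemma one_resonant1_inj {R : realType} {d : nat} {lam : 'rV[R[i]]_d} :
  one_resonant1 lam -> injective (lam 0).
Proof.
move=> res i j lam_ij; apply/eqP/negPn/negP => ij.
have [] := res (fun i' => (i' == i) : nat) j.
rewrite (bigD1 i)//= eqxx expr1 big1 ?mulr1 => [|i' /negPf->]; last by rewrite expr0.
case=> // q qE _; have := qE j; rewrite eqxx eq_sym (negPf ij).
by rewrite addn1.
Qed.

Lemma normal_form_coord {R : realType} {d k : nat} {lam : 'rV[R[i]]_d}
    {z : 'cV[R[i]]_d} {w : 'cV[R[i]]_d} {j : 'I_d} (b := w j 0 - normal_form k lam z j 0) :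
  lam 0 j != 0 -> z j 0 != 0 ->
  w j 0 = lam 0 j * z j 0 *
    (1 - prod_coord z ^+ k / (k * d)%:R + b / (lam 0 j * z j 0)).
Proof.
move=> l0 z0.
have nfE : normal_form k lam z j 0 =
    (1 - prod_coord z ^+ k / (k * d)%:R) * (lam 0 j * z j 0).
  by rewrite mxE mul_diag_mx mxE.
rewrite mulrDr [_ * (b / _)]mulrC divfK ?mulf_neq0// /b nfE; ring.
Qed.

(* Inside [Wset beta], [normc u <= normc (z j 0) * normc u `^ (beta * (d - 1))]
   turns the error [O(normc u `^ (beta * l))] into a relative error
   [O(normc u `^ (beta * (l + d - 1) - 1))], which the hypothesis on [beta] makes
   [O(normc u ^+ (2 * k))]. *)
Lemma relative_error_le {R : realType} {d k l : nat} {beta C : R}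
    {z : 'cV[R[i]]_d} {j : 'I_d} {b x : R[i]} :
  (0 < d)%N -> 0 <= C -> 0 < beta ->
  2 * k%:R + 1 < beta * (l%:R + d%:R - 1) ->
  Wset beta z -> 0 < normc (prod_coord z) <= 1 -> normc x = 1 -> z j 0 != 0 ->
  normc b <= C * (normc (prod_coord z) `^ beta) ^+ l ->
  normc (b / (x * z j 0)) <= C * normc (prod_coord z ^+ k) ^+ 2.
Proof.
move=> d0 C0 beta0 hbeta Wz /andP[u0 u1] x1 z0 bC.
have zj0 : 0 < normc (z j 0) by rewrite normc_gt0.
set u := normc (prod_coord z) in u0 u1 bC *; set W := u `^ beta in bC *.
have W0 : 0 <= W := powR_ge0 _ _.
(* As [u <= 1], a larger exponent gives a smaller power; [beta * (l + d - 1)] exceeds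
   [2 * k + 1]. *)
have WE : W ^+ (l + d.-1) <= u * u ^+ (2 * k).
  rewrite -exprS -powR_mulrn ?powR_ge0// -powRrM -powR_mulrn ?(ltW u0)//.
  apply: ger_powR; first by rewrite u0.
  rewrite natrD -subn1 natrB// addrA -[(2 * k).+1]addn1 natrD natrM.
  exact: ltW.
rewrite normcM normcV normcM x1 mul1r normcX -exprM mulnC ler_pdivrMr//.
(* Multiplying by [u] lets the left side use [u <= normc (z j 0) * W ^+ d.-1], which supplies the
   missing [d - 1] powers of [W]. *)
rewrite -(ler_pM2r u0).
have uz := prod_coord_le j (fun i => ltW (Wz i)); rewrite -/u -/W in uz.
apply: (@le_trans _ _ (C * W ^+ l * (normc (z j 0) * W ^+ d.-1))).
  by apply: ler_pM => //; rewrite ?normc_ge0// ltW.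
rewrite -!mulrA ler_wpM2l// mulrCA [leRHS]mulrC -mulrA ler_wpM2l ?(ltW zj0)//.
by rewrite -exprD.
Qed.

Theorem corollary4p10 (R : realType) (d k l : nat)
  (hd : (2 <= d)%N) (hk : (1 <= k)%N) (hl : (2 * k * d + 1 < l)%N)
  (lam : 'rV[R[i]]_d)
  (lam_unit : forall j : 'I_d, `|lam 0 j| = 1)
  (lam_res : one_resonant1 lam)
  (U : set 'cV[R[i]]_d) (F : 'cV[R[i]]_d -> 'cV[R[i]]_d)
  (F_germ : automorphism_germ U F)
  (F_form : F = normal_form k lam
      +O_ (0 : 'cV[R[i]]_d) (fun z => `|z| ^+ l : (R[i])^o))
  (beta0 theta0 r0 : R)
  (hbeta0 : 0 < beta0 < d%:R^-1)
  (hbeta0l : 2 * k%:R + 1 < beta0 * (l%:R + d%:R - 1))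
  (htheta0 : 0 < theta0 < pi / (2 * k%:R))
  (hr0 : 0 < r0)
  (B_dom : forall h : 'I_k, basin k h r0 theta0 beta0 `<=` U)
  (B_basin : forall h : 'I_k,
      uniform_local_basin F (basin k h r0 theta0 beta0))
  (z0 : 'cV[R[i]]_d)
  (z0_orbit : forall n : nat, exists h : 'I_k,
      basin k h r0 theta0 beta0 (iter n F z0))
  (V : {vspace 'cV[R[i]]_d})
  (V_proper : V != fullv) :
  ~ cvg0_tangent (fun n => iter n F z0) V.
Proof.
move=> [z_neq0 z_cvg0 clusterV]; move/negP: V_proper; apply; apply/eqP.
set z := fun n => iter n F z0 in z_neq0 z_cvg0 clusterV.
have d_gt0 : (0 < d)%N by apply: leq_trans hd.
have m_gt0 : 0 < (k * d)%:R :> R by rewrite ltr0n muln_gt0 hk.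
have m_ge1 : 1 <= (k * d)%:R :> R by rewrite ler1n muln_gt0 hk.
set m := (k * d)%:R : R in m_gt0 m_ge1.
have lam1 j : normc (lam 0 j) = 1.
  by apply/eqP; rewrite -(inj_eq (@complexI R)) -normr_normc lam_unit.
have lam0 j : lam 0 j != 0 by rewrite -normc_gt0 lam1.
pose u n := prod_coord (z n); pose v n := u n ^+ k; pose s n := normc (v n).
(* This is the sector constant of the petals, positive since [k * theta0 < pi / 2]. *)
pose c := cos (k%:R * theta0).
have [c0 c1] : 0 < c /\ c <= 1.
  split; last exact: cos_le1.
  have kR : 0 < k%:R :> R by rewrite ltr0n.
  have /andP[th0 th1] := htheta0; have p0 := pi_gt0 R.
  have : k%:R * theta0 < pi / 2.
    by rewrite -ltr_pdivlMl//; move: th1; rewrite invfM mulrA mulrC mulrA.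
  by move=> ?; apply: cos_gt0_pihalf; have := mulr_gt0 kR th0; lra.
have Wz n : Wset beta0 (z n) by have [h []] := z0_orbit n.
have sec n : u n != 0 /\ c * s n <= complex.Re (v n).
  by have [h [_ zp]] := z0_orbit n; exact: petal_sector hk htheta0 zp.
have u0 n : 0 < normc (u n) by rewrite normc_gt0 (sec n).1.
have zj0 n j : z n j 0 != 0.
  by apply: contraNneq (sec n).1 => zn0; rewrite /u /prod_coord (bigD1 j)//= zn0 mul0r.
have s0 n : 0 <= s n := normc_ge0 _.
have u_cvg0 e : 0 < e -> exists N, forall n, (N <= n)%N -> normc (u n) <= e.
  move=> e0; have e10 : 0 < Num.min e 1 by rewrite lt_min e0/=.
  have [N zN] := cvg0_coord z_cvg0 _ e10; exists N => n Nn.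
  have z1 i : normc (z n i 0) <= 1.
    by apply/ltW; apply: lt_le_trans (zN _ Nn i) _; rewrite ge_min lexx orbT.
  apply: le_trans (prod_coord_le (Ordinal d_gt0) z1) _; rewrite expr1n mulr1.
  by apply/ltW; apply: lt_le_trans (zN _ Nn _) _; rewrite ge_min lexx.
have [Nu u1] := u_cvg0 _ ltr01.
have s_cvg0 e : 0 < e -> exists N, forall n, (N <= n)%N -> s n <= e.
  move=> /u_cvg0[N uN]; exists (maxn N Nu) => n; rewrite geq_max => /andP[Nn Nun].
  apply: le_trans (uN _ Nn); rewrite /s /v normcX -[leRHS]expr1.
  by apply: ler_wiXn2l => //; [exact: normc_ge0|exact: u1].
have [C [e [C0 e0 FC]]] := eqaddO_coord F_form.
have [Nz zN] := cvg0_coord z_cvg0 _ e0.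
pose del n j := (z n.+1 j 0 - normal_form k lam (z n) j 0) / (lam 0 j * z n j 0).
have zS n j : z n.+1 j 0 =
    lam 0 j * z n j 0 * (1 - v n / (k * d)%:R + del n j).
  exact: normal_form_coord.
have /andP[beta_gt0 _] := hbeta0.
have del_le n j : (maxn Nu Nz <= n)%N -> normc (del n j) <= C * s n ^+ 2.
  rewrite geq_max => /andP[Nun Nzn].
  apply: (relative_error_le d_gt0 C0 beta_gt0 hbeta0l (Wz n)) => //.
    by rewrite u0 u1.
  by apply: FC => [|i|i]; [exact: powR_ge0|exact: zN|exact/ltW/Wz].
have vm n : normc (v n / (k * d)%:R) = s n / m.
  by rewrite normcM normcV normc_nat.
have sm n : s n / m <= s n by rewrite ler_piMr ?invf_le1.
pose f n j := normc (1 - v n / (k * d)%:R + del n j).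
pose rho n := normc (1 - v n / (k * d)%:R).
pose zeta n j := normc (z n j 0).
have zeta0 n j : 0 < zeta n j by rewrite normc_gt0.
(* Here [s n] is the decreasing quantity; its linear rate is [c / m] because the step subtracts
   [v n / m], whose real part is at least [c * s n / m]. *)
have [N0 HN0] := comparable_of_parabolic s rho f zeta C (c / m) d_gt0 hk C0
  (divr_gt0 c0 m_gt0) s0 zeta0 s_cvg0.
have [K K0 zK] : exists2 K, 0 < K &
    forall n i j, (maxn N0 (maxn Nu Nz) <= n)%N -> zeta n i <= K * zeta n j.
  apply: HN0 => [|n _ j|n Nn j|n _|n _]; first exact: leq_maxl.
  - by rewrite /zeta zS !normcM lam1 mul1r.
  - have dl := del_le n j (leq_trans (leq_maxr _ _) Nn).
    rewrite ler_distl; apply/andP; split.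
      have := normc_sub_ge (1 - v n / (k * d)%:R) (del n j).
      by rewrite -/(f n j) -/(rho n); lra.
    have := normc_triangle (1 - v n / (k * d)%:R) (del n j).
    by rewrite -/(f n j) -/(rho n); lra.
  (* Multiplying the recursions of all coordinates and taking [k]-th powers gives the recursion of
     [s]; the unimodular [lam 0 j] disappear. *)
  - rewrite /s /v !normcX prodrXl -exprMn !normc_prod -big_split/=.
    by congr (_ ^+ _); apply: eq_bigr => j _; rewrite zS !normcM lam1 mul1r.
  - apply/andP; split.
      have := normc_sub_ge 1 (- (v n / (k * d)%:R)).
      by rewrite normc_opp normc1 vm -/(rho n); have := sm n; lra.
    have vmE : v n / (k * d)%:R = v n * (m^-1)%:C.
      by rewrite fmorphV rmorph_nat.
    have /(normc_sub1_le _ _ c1) : c * normc (v n / (k * d)%:R) <=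
        complex.Re (v n / (k * d)%:R).
      rewrite vm vmE mulrA.
      have -> : complex.Re (v n * (m^-1)%:C) = complex.Re (v n) / m.
        by case: (v n) => a b /=; rewrite mulr0 subr0.
      by rewrite ler_wpM2r ?invr_ge0 ?(ltW m_gt0)//; have [] := sec n.
    rewrite -/(rho n) vm => /le_trans; apply.
    have -> : c * (s n / m) = c / m * s n by ring.
    rewrite lerD2l; apply: lerXn2r; rewrite ?nnegrE//.
    by apply: divr_ge0 => //; exact: ltW.
have enorm0 n : 0 < enorm (z n).
  exact: lt_le_trans (zeta0 n (Ordinal d_gt0)) (normc_le_enorm _ _).
have [p zp] := bounded_limit_pt (direction \o z)
  (fun n j => normc_direction_le1 (z n) j).
(* Comparability gives [enorm (z n) <= d * K * normc (z n j 0)], so each coordinate of the direction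
   is eventually at least [1 / (d * K)] in modulus and cannot accumulate at [0]. *)
have p0 j : p j 0 != 0.
  apply/eqP => pj0.
  have dK : 0 < (d%:R * K)^-1 by rewrite invr_gt0 mulr_gt0// ltr0n.
  have [n Nn /(_ j)] := zp _ dK (maxn N0 (maxn Nu Nz)).
  rewrite pj0 subr0 normc_direction ltNge => /negP; apply.
  rewrite ler_pdivlMl// ler_pdivrMr; last by rewrite mulr_gt0// ltr0n.
  rewrite mulrC -mulrA; apply: enorm_le_const.
    exact/ltW/(mulr_gt0 K0)/zeta0.
  by move=> i; exact: zK.
apply: (@diag_orbit_span _ _ lam p); [exact: one_resonant1_inj|by []|move=> q].
apply: clusterV; apply: limit_pt_cluster; elim: q => // q IH /=.
apply: (limit_pt_direction_step lam z
  (fun n j => - (v n / (k * d)%:R) + del n j)) => // [|e' e'0].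
  by exists 0 => n j _; rewrite zS addrA.
(* Once [s n <= 1], the perturbation is at most [s n + C * s n ^+ 2 <= (1 + C) * s n], hence the
   threshold [e' / (1 + C)]. *)
have [N1 sN1] := s_cvg0 _ (divr_gt0 e'0 (ltr_wpDr C0 ltr01)).
exists (maxn N1 (maxn Nu Nz)) => n j; rewrite geq_max => /andP[N1n Nn].
apply: le_trans (normc_triangle _ _) _; rewrite normc_opp vm.
have s1 : s n <= 1.
  move: Nn; rewrite geq_max => /andP[Nun _].
  by rewrite /s /v normcX exprn_ile1 ?normc_ge0 ?u1.
have := sN1 _ N1n; rewrite ler_pdivlMr; last by lra.
have := del_le n j Nn; have := sm n; have := s0 n.
have : C * s n ^+ 2 <= C * s n.
  by rewrite ler_wpM2l// -[leRHS]expr1 ler_wiXn2l.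
lra.
Qed.
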